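(* Let $\mathbb{F}$ be a field. If a finite simplicial complex $K$ with $m$ vertices is weakly taut over $\mathbb{F}$, then $$\left[\frac{m-1}{2}\right]\le\dim(K)\le m-1.$$
   Context: $[x]$ denotes the integer part (floor) of $x$. A finite simplicial complex $K$ with vertex set $V(K)=[m]=\{v_1,\dots,v_m\}$ contains $\varnothing$ and every singleton $\{v_i\}$ as a face. The dimension of a face $\sigma$ is $|\sigma|-1$; $\mathrm{mdim}(K)$ is the minimal dimension of the maximal simplices of $K$. $\widetilde{D}(K;\mathbb{F})=\dim_{\mathbb{F}}\mathrm{Tor}_{\mathbb{F}[v_1,\dots,v_m]}(\mathbb{F}[K],\mathbb{F})$, where $\mathbb{F}[K]$ is the Stanley-Reisner ring; equivalently (Hochster's formula) $\widetilde{D}(K;\mathbb{F})=\sum_{J\subseteq[m]}\sum_{i\ge -1}\dim_{\mathbb{F}}\widetilde{H}_i(K|_J;\mathbb{F})$, where $K|_J$ is the full subcomplex on $J$ and $\widetilde{H}_{-1}(\{\varnothing\};\mathbb{F})=\mathbb{F}$ is the only nonzero reduced homology group of $\{\varnothing\}$. $K$ with $m$ vertices is weakly taut over $\mathbb{F}$ if $\widetilde{D}(K;\mathbb{F})=2^{m-\mathrm{mdim}(K)-1}$. *)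

(* Defs.v *)
(* MathComp *)
From HB Require Import structures.
From mathcomp Require Import all_boot all_order all_algebra.

Set Implicit Arguments.
Unset Strict Implicit.
Unset Printing Implicit Defensive.

Import Order.TTheory GRing.Theory Num.Theory.

Local Open Scope ring_scope.

Record simplicial_complex (m : nat) : Type := SimplicialComplex {
  faces :> {set {set 'I_m}};
  face0 : set0 \in faces;
  face1 : forall v : 'I_m, [set v] \in faces;
  face_sub : forall s t : {set 'I_m}, t \subset s -> s \in faces -> t \in faces
}.

(* The next three definitions take a bare family of sets L, because the full
   subcomplex K|_J, which is (K ::&: J), need not contain every vertex of 'I_m.
   They are indexed by the cardinality k of the faces, so that k stands for the
   homological degree k - 1 >= -1. *)
Definition kfaces (m : nat) (L : {set {set 'I_m}}) (k : nat) :
    {set {set 'I_m}} :=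
  [set s in L | #|s| == k].

(* Augmented simplicial boundary, acting on row vectors: the face
   {v_0 < ... < v_(k-1)} is sent to the sum over j of
   (-1)^j {v_0, ..., v_(k-1)} \ {v_j}.  For k = 0 the only possible row is the
   empty face, the inner sum is empty and the matrix is zero. *)
Definition boundary (F : fieldType) (m : nat) (L : {set {set 'I_m}}) (k : nat) :
    'M[F]_(#|kfaces L k|, #|kfaces L k.-1|) :=
  \matrix_(a, b)
    let s : {set 'I_m} := enum_val a in
    let t : {set 'I_m} := enum_val b in
    \sum_(v in s | s :\ v == t) (-1) ^+ #|[set w in s | (w < v)%N]|.

(* dim_F of the reduced homology of L in degree k - 1; (A :\: B)%MS is a
   complement of A :&: B in A, hence a copy of the quotient ker / im. *)
Definition reduced_betti (F : fieldType) (m : nat) (L : {set {set 'I_m}})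
    (k : nat) : nat :=
  \rank (kermx (boundary F L k) :\: boundary F L k.+1)%MS.

(* The total dimension of Tor_{F[v_1, ..., v_m]}(F[K], F), given by Hochster's
   formula.  There are no faces of cardinality above m. *)
Definition Dtilde (F : fieldType) (m : nat) (K : simplicial_complex m) : nat :=
  (\sum_(J : {set 'I_m}) \sum_(k < m.+1) reduced_betti F (K ::&: J) k)%N.

(* Dimensions are integers: the complex {set0}, obtained for m = 0, has
   dimension -1. *)
Definition complex_dim (m : nat) (K : simplicial_complex m) : int :=
  (\max_(s in K) #|s|)%:Z - 1.

(* The default value m is never smaller than the cardinality of a face, and
   maximal faces exist, so this is the minimum over the maximal faces. *)
Definition mdim (m : nat) (K : simplicial_complex m) : int :=
  (\big[minn/m]_(s : {set 'I_m} | maxset [in faces K] s) #|s|)%:Z - 1.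

(* Stated in rat so that the integer power of 2 is the genuine one. *)
Definition weakly_taut (F : fieldType) (m : nat) (K : simplicial_complex m) :
    Prop :=
  (Dtilde F K)%:R = 2%:R ^ (m%:Z - mdim K - 1) :> rat.

(* Main.v *)
(* Let s be a maximal face with Dtilde K <= 2^(m - |s|).  Sort the vertex sets J
   by B = J \ s.  Each B disjoint from s contributes at least 1 to Hochster's
   sum: the link of s is {set0}, which has homology, and the Mayer-Vietoris
   sequences that add the vertices of s to the link one at a time carry this
   class back to K|_(B u S), in degree |S| - 1, for some S included in s.  So
   each B contributes exactly 1.  A minimal nonface B disjoint from s would
   contribute a second class, the fundamental class of the simplex boundary
   K|_B.  Hence the complement of s is a face as well, and one of the two faces
   has at least m/2 vertices. *)
Require Import Defs.
From mathcomp Require Import all_boot all_order all_algebra.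
From mathcomp Require Import ring zify.

Import Order.TTheory GRing.Theory Num.Theory.

Local Open Scope ring_scope.

(** * Chains as functions on sets, and their boundary *)

Section Chains.

Set Implicit Arguments.
Unset Strict Implicit.

Variables (F : fieldType) (m : nat).
Implicit Types (v x : 'I_m) (s t : {set 'I_m}) (L : {set {set 'I_m}}).
Implicit Types c w z : {set 'I_m} -> F.

Definition inc_sign v t : F := (-1) ^+ #|[set w in t | (w < v)%N]|.

(** The coefficient of [t] in the simplicial boundary of the chain [c]. Chains are functions on all
    sets, so that chains of different complexes can be compared without re-indexing. *)
Definition bd c t : F := \sum_(v | v \notin t) inc_sign v t * c (v |: t).

Definition chain_on L k c := forall s, s \notin kfaces L k -> c s = 0.

Definition acyclic_at L k := forall c, chain_on L k c -> (forall t, bd c t = 0) ->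
  exists2 w, chain_on L k.+1 w & forall t, bd w t = c t.

Lemma inc_sign_sq v t : inc_sign v t * inc_sign v t = 1.
Proof. by rewrite -expr2 sqrr_sign. Qed.

Lemma inc_signU v x t : v \notin t ->
  inc_sign x (v |: t) = (-1) ^+ (v < x)%N * inc_sign x t.
Proof.
move=> vt; rewrite /inc_sign -exprD; congr (_ ^+ _).
case: (boolP (v < x)%N) => vx.
  rewrite -[RHS]/(1 + _)%N.
  have -> : [set w in v |: t | (w < x)%N] = v |: [set w in t | (w < x)%N].
    apply/setP => w; rewrite !inE; case: eqP => //= ->; by rewrite vx.
  by rewrite cardsU1 inE (negPf vt).
congr #|pred_of_set _|; apply/setP => w; rewrite !inE; case: eqP => //= ->.
by rewrite (negPf vx) andbF.
Qed.

(** By [inc_signU] both sides are [inc_sign v t * inc_sign x t] up to sign, and exactly one of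
    [v < x] and [x < v] holds. *)
Lemma inc_sign_swap v x t : x != v -> v \notin t -> x \notin t ->
  inc_sign v t * inc_sign x (v |: t) = - (inc_sign x t * inc_sign v (x |: t)).
Proof.
move=> xv vt xt; rewrite !inc_signU //.
have [vx|vx|/val_inj vx] := ltngtP v x; last by rewrite vx eqxx in xv.
  by rewrite expr0 expr1; ring.
by rewrite expr0 expr1; ring.
Qed.

Lemma bd_bd c t : bd (bd c) t = 0.
Proof.
pose f v x := inc_sign v t * (inc_sign x (v |: t) * c (x |: (v |: t))).
have fN v x : x != v -> v \notin t -> x \notin t -> f v x = - f x v.
  by move=> *; rewrite /f !mulrA inc_sign_swap // mulNr setUCA.
have -> : bd (bd c) t =
    \sum_(v | v \notin t) \sum_(x | (x \notin t) && (x != v)) f v x.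
  apply: eq_bigr => v vt; rewrite big_distrr /=; apply: eq_bigl => x.
  by rewrite !inE negb_or andbC.
(* Splitting by the order of v and x avoids dividing by 2. *)
rewrite (eq_bigr (fun v => \sum_(x | (x \notin t) && (x < v)%N) f v x
                         + \sum_(x | (x \notin t) && (v < x)%N) f v x)); last first.
  move=> v vt; rewrite (bigID (fun x => (x < v)%N)) /=; congr (_ + _);
    apply: eq_bigl => x; rewrite -andbA; congr (_ && _); rewrite -val_eqE /=; lia.
rewrite big_split /= addrC.
rewrite (exchange_big_dep (fun x => x \notin t)) /=; last by move=> v x _ /andP[].
rewrite -big_split /= big1 // => v vt.
rewrite (eq_bigl (fun x => (x \notin t) && (x < v)%N)); last by move=> x; rewrite vt.
rewrite -big_split big1 //= => x /andP[xt xv].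
by rewrite fN // ?addNr // -val_eqE /= neq_ltn xv orbT.
Qed.

(** * Comparison with the boundary matrices *)

Lemma chain_onP L k c s : chain_on L k c -> ~~ ((s \in L) && (#|s| == k)) -> c s = 0.
Proof. by move=> h hs; apply: h; rewrite inE. Qed.

Lemma bd_not_kface L k w t : (forall s s', s' \subset s -> s \in L -> s' \in L) ->
  chain_on L k.+1 w -> t \notin kfaces L k -> bd w t = 0.
Proof.
move=> down wL tL; rewrite /bd big1 // => v vt.
rewrite (chain_onP wL) ?mulr0 //; apply: contra tL => /andP[vtL].
rewrite cardsU1 vt eqSS => ct; rewrite inE ct andbT.
exact: down (subsetUr _ _) vtL.
Qed.

Lemma row_boundaryE L k c b : chain_on L k c ->
  ((\row_a c (enum_val a)) *m boundary F L k) 0 b = bd c (enum_val b).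
Proof.
move=> cL; rewrite mxE; set t := enum_val b.
pose g s := c s * \sum_(v in s | s :\ v == t) (-1) ^+ #|[set w in s | (w < v)%N]|.
transitivity (\sum_(a < #|kfaces L k|) g (enum_val a)).
  by apply: eq_bigr => a _; rewrite !mxE.
rewrite -(big_enum_val g) /=.
have -> : \sum_(s in kfaces L k) g s = \sum_s g s.
  rewrite [RHS](bigID (mem (kfaces L k))) /= [X in _ + X]big1 ?addr0 //.
  by move=> s sL; rewrite /g cL ?mul0r.
under eq_bigr do rewrite /g big_distrr /=.
(* For fixed [v], the only [s] containing [v] with [s :\ v = t] is [v |: t], and there is none if
   [v] lies in [t]. *)
rewrite (exchange_big_dep predT) //= /bd [RHS]big_mkcond /=.
apply: eq_bigr => v _; case: ifPn => vt; last first.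
  rewrite big1 // => s /andP[_ /eqP st]; move: vt; rewrite -st.
  by rewrite !inE eqxx.
rewrite (big_pred1 (v |: t)) => [|s].
  rewrite mulrC; congr (_ ^+ _ * _); congr #|pred_of_set _|; apply/setP => w.
  by rewrite !inE; case: eqP => //= ->; rewrite ltnn andbF.
apply/andP/eqP => [[vs /eqP <-]|->]; first by rewrite setD1K.
by rewrite setU11 setU1K.
Qed.

Lemma betti0_acyclic L k : (forall s s', s' \subset s -> s \in L -> s' \in L) ->
  reduced_betti F L k = 0%N -> acyclic_at L k.
Proof.
move=> down /eqP; rewrite mxrank_eq0 => /eqP D0 c cL c0.
have ker_im : (kermx (boundary F L k) <= boundary F L k.+1)%MS.
  rewrite -(addsmx_diff_cap_eq _ (boundary F L k.+1)) D0 addsmx_sub sub0mx.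
  exact: capmxSr.
have /submxP[d dE] : (\row_a c (enum_val a) <= boundary F L k.+1)%MS.
  apply: submx_trans ker_im; apply/sub_kermxP/rowP => b.
  by rewrite row_boundaryE // c0 mxE.
(* The row vector [d], extended by zero to all sets. *)
pose w s := if [pick a : 'I_#|kfaces L k.+1| | enum_val a == s] is Some a
            then d 0 a else 0.
have wE a : w (enum_val a) = d 0 a.
  by rewrite /w; case: pickP => [b /eqP/enum_val_inj->|/(_ a)/eqP[]].
have wL : chain_on L k.+1 w.
  move=> s sL; rewrite /w; case: pickP => // a /eqP sE.
  by rewrite -sE enum_valP in sL.
exists w => // t.
case: (boolP (t \in kfaces L k)) => tL; last first.
  by rewrite (cL t tL) (bd_not_kface down wL tL).
rewrite -(enum_rankK_in tL tL) -(@row_boundaryE _ k.+1) //.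
have -> : \row_a w (enum_val a) = d by apply/rowP => a; rewrite mxE wE.
by rewrite -dE mxE.
Qed.

(** * Deletion and link of a vertex *)

Definition link_part v c t := if v \in t then 0 else inc_sign v t * c (v |: t).

(** Write c = v * a + r with v put first, where a is [link_part v c] and v occurs in neither a nor
    r. The terms of the boundary of c that contain v are those of - v * bd a. *)
Lemma bd_link_part v c t : bd (link_part v c) t = - link_part v (bd c) t.
Proof.
rewrite {2}/link_part; case: ifPn => vt.
  by rewrite oppr0 /bd big1 // => x _; rewrite /link_part setU1r // mulr0.
rewrite {1}/bd (bigD1 v) //= {1}/link_part setU11 mulr0 add0r.
rewrite mulr_sumr -sumrN.
rewrite (eq_bigl (fun x => x \notin v |: t)) => [|x]; last first.
  by rewrite !inE negb_or andbC.
apply: eq_bigr => x; rewrite !inE negb_or => /andP[xv xt].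
rewrite /link_part !inE eq_sym (negPf xv) (negPf vt) /= !mulrA setUCA.
by rewrite inc_sign_swap // mulNr opprK.
Qed.

(** In the same decomposition, the terms without v of bd (v * a + r) are those of a + bd r. *)
Lemma bd_split v c t : v \notin t ->
  bd c t = link_part v c t + bd (fun s => if v \in s then 0 else c s) t.
Proof.
move=> vt; rewrite /link_part (negPf vt) /bd (bigD1 v) //=; congr (_ + _).
rewrite [RHS](bigD1 v) //= setU11 mulr0 add0r.
apply: eq_bigr => x /andP[xt xv].
by rewrite !inE eq_sym (negPf xv) (negPf vt).
Qed.

(* The part of the Mayer-Vietoris sequence of L = (L - v) u (v * link v) that
   surrounds the homology of the link. *)
Lemma acyclic_link L v k :
    (forall s, v \notin s -> v |: s \in L -> s \in L) ->
  acyclic_at [set s : {set 'I_m} in L | v \notin s] k -> acyclic_at L k.+1 ->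
  acyclic_at [set s : {set 'I_m} | (v \notin s) && (v |: s \in L)] k.
Proof.
move=> lk_del acD acL z z_on z0.
have [|w w_on wz] := acD z _ z0.
  move=> s sD; apply: z_on; apply: contra sD; rewrite !inE.
  by move=> /andP[/andP[vs vsL] ->]; rewrite vs (lk_del s).
(* The chain v * z - w: the cone over z and the filling w of z in the deletion have the same v-free
   boundary, so they glue to a cycle of [L]. *)
pose c s := if v \in s then inc_sign v (s :\ v) * z (s :\ v) else - w s.
have linkc t : link_part v c t = z t.
  rewrite /link_part /c; case: ifPn => vt; last first.
    by rewrite setU11 setU1K // mulrA inc_sign_sq mul1r.
  by rewrite (chain_onP z_on) // inE vt.
have [||u u_on uc] := acL c.
- move=> s sL; rewrite /c; case: ifPn => vs; last first.
    rewrite (chain_onP w_on) ?oppr0 // !inE; apply: contra sL.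
    by move=> /andP[/andP[sL _] sk]; rewrite inE sL.
  rewrite (chain_onP z_on) ?mulr0 // !inE eqxx /= setD1K //.
  apply: contra sL => /andP[sL sk]; rewrite inE sL.
  by rewrite (cardsD1 v) vs add1n eqSS.
- have bd0 t : v \notin t -> bd c t = 0.
    move=> vt; rewrite (bd_split c vt) linkc -wz.
    rewrite -[RHS](addrN (bd w t)); congr (_ + _).
    rewrite /bd -sumrN; apply: eq_bigr => x xt; rewrite -mulrN; congr (_ * _).
    case: ifPn => vxt; last by rewrite /c (negPf vxt).
    by rewrite (chain_onP w_on) ?oppr0 // inE vxt andbF.
  move=> t; case: (boolP (v \in t)) => vt; last exact: bd0.
  have := bd_link_part v c (t :\ v).
  rewrite [bd _ _](_ : _ = bd z (t :\ v)); last first.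
    by apply: eq_bigr => x _; rewrite linkc.
  rewrite z0 /link_part setD11 setD1K // => /esym/eqP.
  by rewrite oppr_eq0 mulf_eq0 signr_eq0 => /eqP.
(* If u fills c, then minus its link part fills the link part z of c, because [link_part]
   anticommutes with [bd]. *)
exists (fun t => - link_part v u t).
  move=> t tL; rewrite /link_part; case: ifPn => vt; first by rewrite oppr0.
  rewrite (chain_onP u_on) ?mulr0 ?oppr0 //; apply: contra tL.
  by rewrite cardsU1 vt eqSS => /andP[vtL tk]; rewrite !inE vt vtL.
move=> t; transitivity (- bd (link_part v u) t).
  by rewrite /bd -sumrN; apply: eq_bigr => x _; rewrite mulrN.
rewrite bd_link_part opprK -linkc /link_part; case: ifP => // _.
by rewrite uc.
Qed.

End Chains.

(** * Iterated links in [K] and nonzero Betti numbers *)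

Section Tautness.

Set Implicit Arguments.
Unset Strict Implicit.

Variables (F : fieldType) (m : nat) (K : simplicial_complex m).
Implicit Types (s t A B S T : {set 'I_m}).

(** The link of [T] in the full subcomplex on the union of [A] and [T]. *)
Definition link_on T A : {set {set 'I_m}} :=
  [set s : {set 'I_m} | [&& s \subset A, [disjoint s & T] & s :|: T \in faces K]].

Lemma link_on0 A : link_on set0 A = K ::&: A.
Proof. by apply/setP => s; rewrite !inE -setI_eq0 setI0 eqxx setU0 andbC. Qed.

(** This is [acyclic_link] in [link_on T (v |: A)], whose deletion of [v] is [link_on T A] and whose
    link of [v] is [link_on (v |: T) A]. *)
Lemma acyclic_at_link_on v T A k : v \notin T -> v \notin A ->
  acyclic_at F (link_on T A) k -> acyclic_at F (link_on T (v |: A)) k.+1 ->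
  acyclic_at F (link_on (v |: T) A) k.
Proof.
move=> vT vA acA acvA.
have -> : link_on (v |: T) A =
    [set s : {set 'I_m} | (v \notin s) && (v |: s \in link_on T (v |: A))].
  apply/setP => s; rewrite !inE.
  case: (boolP (v \in s)) => vs /=.
    apply/negP => /and3P[/subsetP/(_ v vs) vA' _ _].
    by rewrite vA' in vA.
  have vs' : [disjoint s & [set v]] by rewrite disjoint_sym disjoints1.
  rewrite subUset sub1set setU11 -subDset (setDidPl vs') setUCA setUA /=.
  by rewrite -!setI_eq0 setIUr setIUl !setU_eq0 !setI_eq0 vs' disjoints1 vT.
apply: acyclic_link => [s vs||].
- rewrite !inE => /and3P[sA dsT sTK]; apply/and3P; split.
  + move: sA; rewrite subUset => /andP[_]; rewrite -subDset.
    by have /setDidPl-> : [disjoint s & [set v]] by rewrite disjoint_sym disjoints1.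
  + by move: dsT; rewrite -!setI_eq0 setIUl setU_eq0 => /andP[].
  + by apply: face_sub sTK; rewrite setUSS ?subsetUr.
- congr acyclic_at: acA; apply/setP => s; rewrite !inE.
  case: (boolP (v \in s)) => vs; last first.
    rewrite andbT -subDset.
    by have /setDidPl-> : [disjoint s & [set v]] by rewrite disjoint_sym disjoints1.
  rewrite andbF; apply/negP => /and3P[/subsetP/(_ v vs) vA' _ _].
  by rewrite vA' in vA.
- exact: acvA.
Qed.

Lemma betti0_acyclic_at_link_on A k :
  reduced_betti F (K ::&: A) k = 0%N -> acyclic_at F (link_on set0 A) k.
Proof.
rewrite link_on0; apply: betti0_acyclic => s t ts; rewrite !inE => /andP[sK sA].
by rewrite (face_sub ts sK) (subset_trans ts sA).
Qed.

Lemma exists_betti_neq0 s B : maxset [in faces K] s -> [disjoint B & s] ->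
  exists2 S : {set 'I_m}, S \subset s & reduced_betti F (K ::&: (S :|: B)) #|S| != 0%N.
Proof.
move=> /maxsetP[sK s_max] dBs.
apply/exists_inP; apply: contraT; rewrite negb_exists_in => /forall_inP b0.
(* Each vertex taken out of [T] is either dropped, in the same degree, or moved to [S], one degree
   higher; so the degree stays [#|S|], and the case of empty [T] is the assumption [b0]. *)
have acT n : forall T S, #|T| = n -> S :|: T \subset s -> [disjoint S & T] ->
    acyclic_at F (link_on T (S :|: B)) #|S|.
  elim: n => [|n IHn] T S cT STs dST.
    rewrite (cards0_eq cT); apply: betti0_acyclic_at_link_on.
    by apply/eqP; rewrite -[_ == _]negbK b0 // (subset_trans _ STs) ?subsetUl.
  have /card_gt0P[v vT] : (0 < #|T|)%N by rewrite cT.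
  have vs : v \in s by rewrite (subsetP STs) // inE vT orbT.
  have vS : v \notin S by rewrite (disjointFl dST).
  have vB : v \notin B by rewrite (disjointFl dBs).
  have cTv : #|T :\ v| = n by move: cT; rewrite (cardsD1 v) vT => -[].
  rewrite -(setD1K vT); apply: acyclic_at_link_on.
  - by rewrite setD11.
  - by rewrite inE negb_or vS.
  - apply: IHn => //; first by rewrite (subset_trans _ STs) ?setUS ?subD1set.
    by apply: disjointWr dST; apply: subD1set.
  - have <- : #|v |: S| = #|S|.+1 by rewrite cardsU1 vS.
    rewrite setUA; apply: IHn => //.
      by rewrite -setUA setUCA setD1K.
    rewrite -setI_eq0 setIUl setU_eq0 !setI_eq0 disjoints1 setD11 /=.
    by apply: disjointWr dST; apply: subD1set.
have := acT #|s| s set0 erefl; rewrite set0U -setI_eq0 set0I eqxx set0U cards0.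
move=> /(_ (subxx _) isT) ac.
have linkE A : A \in link_on s B -> A = set0.
  rewrite inE => /and3P[_ /disjoint_setI0 <- /s_max/(_ (subsetUr _ _)) As].
  by apply/esym/setIidPl; rewrite -As subsetUl.
have [||w w_on] := ac (fun A => (A == set0)%:R).
- move=> A; rewrite !inE; case: (A =P set0) => [->|] //.
  by rewrite sub0set cards0 set0U sK -setI_eq0 set0I eqxx.
- move=> t; rewrite /bd big1 // => v vt.
  by rewrite setU_eq0 -cards_eq0 cards1 /= mulr0.
move=> /(_ set0); rewrite eqxx /bd big1 => [/esym/eqP|v _].
  by rewrite oner_eq0.
rewrite (chain_onP w_on) ?mulr0 //; apply/negP => /andP[/linkE->].
by rewrite cards0.
Qed.

Lemma min_nonface_betti_neq0 B : minset [pred t | t \notin faces K] B ->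
  reduced_betti F (K ::&: B) #|B|.-1 != 0%N.
Proof.
move=> /minsetP[/= BK B_min].
have /set0Pn[v vB] : B != set0.
  by apply: contraNneq BK => ->; apply: face0.
have cB : #|B|.-1.+1 = #|B| by rewrite prednK // card_gt0; apply/set0Pn; exists v.
have facet x : x \in B -> B :\ x \in faces K.
  move=> xB; apply: contraT => /B_min/(_ (subD1set _ _)) Bx.
  by move: xB; rewrite -Bx setD11.
apply/eqP => /betti0_acyclic_at_link_on; rewrite link_on0.
(* The simplex on [B] is not a chain of [K], but its boundary is. A filling in the full subcomplex
   on [B] would need a face with [#|B|] elements, hence [B] itself, so it is zero. *)
pose d s : F := (s == B)%:R.
move=> /(_ (bd d))[||w].
- move=> t tB; rewrite /bd big1 // => x xt; rewrite /d.
  case: eqP => [xtB|_]; last by rewrite mulr0.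
  have xB : x \in B by rewrite -xtB setU11.
  case/negP: tB; have -> : t = B :\ x by rewrite -xtB setU1K.
  rewrite !inE facet // subD1set /=.
  by rewrite (cardsD1 x B) xB.
- exact: bd_bd.
rewrite cB => w_on /(_ (B :\ v)).
rewrite {1}/bd big1 => [|x _].
  rewrite /bd (bigD1 v) ?setD11 //= setD1K // /d eqxx mulr1 big1 => [|x].
    by rewrite addr0 => /esym/eqP; rewrite signr_eq0.
  rewrite !inE negb_and negbK => /andP[xB xv]; rewrite (negPf xv) /= in xB.
  case: eqP => [xE|_]; last by rewrite mulr0.
  by move: xB; rewrite -xE setU11.
rewrite (chain_onP w_on) ?mulr0 //; apply/negP => /andP[].
rewrite inE => /andP[tK tB] /eqP ct.
have tE : x |: B :\ v = B by apply/eqP; rewrite eqEcard tB ct leqnn.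
by move: BK; rewrite -tE tK.
Qed.

(** * Counting in Hochster's sum *)

Lemma setC_maxface s : maxset [in faces K] s ->
  (Dtilde F K <= 2 ^ (m - #|s|))%N -> ~: s \in faces K.
Proof.
move=> s_max; apply: contraTT => sCK; rewrite -ltnNge.
have [B B_min Bs] := @minset_exists _ [pred t | t \notin faces K] _ sCK.
have /minsetP[/= BK _] := B_min.
rewrite /Dtilde pair_bigA /=.
pose b (p : {set 'I_m} * 'I_m.+1) := reduced_betti F (K ::&: p.1) p.2.
rewrite (partition_big (fun p : _ * _ => p.1 :\: s) (mem (powerset (~: s)))) /=;
  last by move=> p _; rewrite powersetE setDE subsetIr.
rewrite -/b.
(* One class for each [A] disjoint from [s] and a second one for [A = B] already exceed the bound by
   one. *)
have cardE : (\sum_(A in powerset (~: s)) (1 + (A == B)) = (2 ^ (m - #|s|)).+1)%N.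
  rewrite big_split /= sum1_card card_powerset cardsCs setCK card_ord.
  by rewrite (bigD1 B) ?powersetE //= eqxx big1 ?addn1 // => A /andP[_ /negPf->].
rewrite -cardE; apply: leq_sum => A; rewrite powersetE => As.
have dAs : [disjoint A & s] by rewrite disjoints_subset.
have [S Ss bS] := exists_betti_neq0 s_max dAs.
have AS : (S :|: A) :\: s = A.
  by rewrite setDUl (eqP (_ : S :\: s == set0)) ?setD_eq0 // set0U; apply/setDidPl.
have le_m (T : {set 'I_m}) : (#|T| < m.+1)%N by rewrite ltnS -[leqRHS]card_ord max_card.
rewrite (bigD1 (S :|: A, inord #|S|)) /= ?AS ?eqxx //; apply: leq_add.
  by rewrite lt0n /= inordK.
case: eqP => // AB; subst A.
have lt_m : (#|B|.-1 < m.+1)%N by rewrite (leq_ltn_trans (leq_pred _)).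
rewrite (bigD1 (B, inord #|B|.-1)) /=.
  rewrite ltn_addr // lt0n inordK //; exact: min_nonface_betti_neq0.
rewrite (setDidPl _) // eqxx /= xpair_eqE.
(* If the two summands coincided, [S] would lie in both [B] and [s], hence be empty; then
   [#|B| <= 1], but the empty set and the singletons are faces. *)
apply/negP => /andP[/eqP SB /eqP /(congr1 val)]; rewrite /= !inordK // => cE.
have S0 : S = set0.
  apply/eqP; rewrite -subset0 -(disjoint_setI0 dAs) subsetI Ss andbT.
  by rewrite SB subsetUl.
move: (BK); have [v ->] : exists v, B = [set v].
  apply/cards1P; move: cE; rewrite S0 cards0.
  case: (posnP #|B|) => [/cards0_eq B0|]; last by case: #|B| => // -[].
  by move: BK; rewrite B0 face0.
by rewrite face1.
Qed.

Lemma weakly_taut_maxface : weakly_taut F K ->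
  exists2 s : {set 'I_m}, maxset [in faces K] s & (Dtilde F K <= 2 ^ (m - #|s|))%N.
Proof.
rewrite /weakly_taut /mdim.
set n := (\big[minn/m]_(s : {set 'I_m} | maxset [in faces K] s) #|s|)%N => D_eq.
have le_m (T : {set 'I_m}) : (#|T| <= m)%N by rewrite -[leqRHS]card_ord max_card.
have n_le : (n <= m)%N.
  by apply: (big_ind (fun x => x <= m)%N) => // x y xm _; rewrite geq_min xm.
have {}D_eq : Dtilde F K = (2 ^ (m - n))%N.
  apply/eqP; rewrite -(eqr_nat rat) D_eq natrX; apply/eqP.
  by rewrite exprnP; congr (_ ^ _); lia.
(* If the minimum is the default value [m], then [Dtilde F K] is 1 and any maximal face will do. *)
have [nm|] : n = m \/ exists2 s : {set 'I_m}, maxset [in faces K] s & #|s| = n.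
- pose P x := x = m \/ exists2 s, maxset [in faces K] s & #|s| = x.
  apply: (big_ind P).
  + by left.
  + by move=> x y Px Py; case: (leqP x y).
  + by move=> s s_max; right; exists s.
- have [s s_max _] := maxset_exists (face0 K); exists s => //.
  by rewrite D_eq nm subnn expn_gt0.
- by case=> s s_max sn; exists s => //; rewrite D_eq sn.
Qed.

End Tautness.

(* (a %/ 2)%Z rounds towards minus infinity, i.e. it is the floor of a / 2. *)
Theorem corollary5p15 (F : fieldType) (m : nat) (K : simplicial_complex m)
    (hK : weakly_taut F K) :
  ((m%:Z - 1) %/ 2)%Z <= complex_dim K /\ complex_dim K <= m%:Z - 1.
Proof.
have [s s_max Ds] := weakly_taut_maxface hK.
have sCK := setC_maxface s_max Ds.
have /maxsetP[/= sK _] := s_max.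
rewrite /complex_dim.
have dim_ge (t : {set 'I_m}) : t \in faces K -> (#|t| <= \max_(s in K) #|s|)%N.
  by move=> tK; rewrite (bigD1 t) // leq_maxl.
have dim_le : (\max_(s in K) #|s| <= m)%N.
  by apply/bigmax_leqP => t _; rewrite -[leqRHS]card_ord max_card.
(* The cardinalities of [s] and its complement add up to m, so the largest face has d >= m/2
   vertices; as d is an integer, d - 1 is at least the floor of (m - 1)/2. *)
have := dim_ge _ sK; have := dim_ge _ sCK; have := cardsC s; rewrite card_ord.
move: (\max_(s in K) #|s|)%N dim_le => d dm sC dC ds.
split; lia.
Qed.
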